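(* For all integers $m,n\ge 1$, $(m,n)\text{-RPDA} \subsetneq (m,n+1)\text{-RPDA}$. In addition, the witness languages are binary; that is, for all $m,n\ge 1$ there is a language over a two-letter input alphabet that belongs to $(m,n+1)\text{-RPDA}$ but not to $(m,n)\text{-RPDA}$.
   Context: Alphabets are finite nonempty sets; $\varepsilon$ denotes the empty string. A realtime pushdown automaton is $M=(Q,\Sigma,\Gamma,\delta,q_0,Z_0,F)$ with finite state set $Q$, input alphabet $\Sigma$, pushdown alphabet $\Gamma$, initial state $q_0\in Q$, initial pushdown symbol $Z_0\in\Gamma$, accepting states $F\subseteq Q$, and transition function $\delta$ from $Q\times\Gamma\times\Sigma$ to finite subsets of $Q\times\Gamma^*$ with $|\delta(q,A,a)|\le 1$ for all $q\in Q$, $A\in\Gamma$, $a\in\Sigma$ (so it is deterministic and has no $\varepsilon$-transitions). Configurations are triples $(q,\gamma,\sigma)\in Q\times\Gamma^*\times\Sigma^*$ (state, pushdown content with the top as the rightmost symbol, unread input). The step relation is $(q,\gamma A,a\sigma)\vdash(p,\gamma w,\sigma)$ whenever $(p,w)\in\delta(q,A,a)$; $\vdash^*$ is its reflexive and transitive closure. Acceptance is by final state and empty pushdown: $L(M)=\{w\in\Sigma^*\mid(q_0,Z_0,w)\vdash^*(f,\varepsilon,\varepsilon)\text{ for some }f\in F\}$. For one-state (stateless) automata, i.e. $|Q|=1$, an initial pushdown string $\alpha\in\Gamma^+$ is allowed in place of the initial pushdown symbol $Z_0$, and acceptance is by empty pushdown. An $m$-state automaton is one with $|Q|=m$. The family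 $(m,n)\text{-RPDA}$ consists of all languages accepted by an $m$-state realtime pushdown automaton with $|\Gamma|\le n$. *)

(* Defs.v *)
From HB Require Import structures.
From mathcomp Require Import all_boot finmap.
From Stdlib Require Import Relation_Operators.

Set Implicit Arguments.
Unset Strict Implicit.
Unset Printing Implicit Defensive.

(* [rpda_init] is the initial pushdown string: a single symbol [:: Z0] in
   general, an arbitrary nonempty string when there is only one state. *)
Record rpda (Sigma : finType) : Type := Rpda {
  rpda_Q : finType;
  rpda_Gamma : finType;
  rpda_delta : rpda_Q -> rpda_Gamma -> Sigma ->
    {fset (rpda_Q * seq rpda_Gamma)%type};
  rpda_q0 : rpda_Q;
  rpda_init : seq rpda_Gamma;
  rpda_F : {set rpda_Q};
  rpda_input_nonempty : 0 < #|Sigma|;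
  rpda_delta_det : forall q A a, #|` rpda_delta q A a| <= 1;
  rpda_init_wf : if #|rpda_Q| == 1 then 0 < size rpda_init
                 else size rpda_init == 1
}.

Section Semantics.

Variables (Sigma : finType) (M : rpda Sigma).

Definition config : Type := (rpda_Q M * seq (rpda_Gamma M) * seq Sigma)%type.

(* The top of the pushdown is its rightmost symbol. *)
Inductive step : config -> config -> Prop :=
| Step q gamma A a sigma p (w : seq (rpda_Gamma M)) :
    (p, w) \in rpda_delta q A a ->
    step (q, rcons gamma A, a :: sigma) (p, gamma ++ w, sigma).

Definition steps : config -> config -> Prop := clos_refl_trans config step.

(* A one-state automaton accepts by empty pushdown alone: F is ignored. *)
Definition accepting (f : rpda_Q M) : bool :=
  (#|rpda_Q M| == 1) || (f \in rpda_F M).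

Definition accepted (w : seq Sigma) : Prop :=
  exists2 f : rpda_Q M, accepting f &
    steps (rpda_q0 M, rpda_init M, w) (f, [::], [::]).

End Semantics.

Definition language (Sigma : finType) : Type := seq Sigma -> Prop.

Definition lang_family : Type := forall Sigma : finType, language Sigma -> Prop.

Definition RPDA (m n : nat) : lang_family := fun Sigma L =>
  exists M : rpda Sigma,
    [/\ #|rpda_Q M| = m, #|rpda_Gamma M| <= n
      & forall w : seq Sigma, L w <-> accepted M w].

Definition subfamily (C D : lang_family) : Prop :=
  forall (Sigma : finType) (L : language Sigma), C Sigma L -> D Sigma L.

Definition proper_subfamily (C D : lang_family) : Prop :=
  subfamily C D /\ ~ subfamily D C.

Arguments RPDA m n Sigma L : clear implicits.

(* Main.v *)
(**
The witness is [L = {b^i a | i < m(n+1)}], with [a = true] and [b = false].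
Every step pops one symbol and reads one letter, so a configuration from which
[a] is accepted has pushdown height exactly one; with [n] pushdown symbols
there are at most [mn] of them.  As [mn < m(n+1)], some [b^i] and [b^j] with
[i < j] lead to the same configuration, and exchanging them makes
[b^(m(n+1)-1+j-i) a] accepted.  Conversely, with [n+1] symbols the letter [b]
can run once through all [m(n+1)] pairs (state, symbol) while [a] pops.
*)
Require Import Defs.
From mathcomp Require Import all_boot finmap zify.
From Stdlib Require Import Relation_Operators Operators_Properties.

Set Implicit Arguments.
Unset Strict Implicit.
Unset Printing Implicit Defensive.

Section Runs.

Variables (Sigma : finType) (M : rpda Sigma).
Implicit Types (q p f : rpda_Q M) (g : seq (rpda_Gamma M)).

Lemma stepP q g (s : seq Sigma) (d : config M) :
  step (q, g, s) d ->
  exists g' A a s' p w, [/\ g = rcons g' A, s = a :: s',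
    (p, w) \in rpda_delta q A a & d = (p, g' ++ w, s')].
Proof.
move=> st.
remember (q, g, s) as c eqn:def_c.
case: st def_c => q1 g1 A a s1 p w dqA [<- <- <-].
by exists g1, A, a, s1, p, w.
Qed.

Lemma steps_first (c d : config M) :
  steps c d -> c = d \/ exists2 c', step c c' & steps c' d.
Proof.
move=> cd; case: (clos_rt_rt1n _ _ _ _ cd) => [|c' e st rest]; first by left.
by right; exists c' => //; apply: clos_rt1n_rt.
Qed.

Lemma steps_cons (c c' d : config M) : step c c' -> steps c' d -> steps c d.
Proof. by move=> st; apply: rt_trans; apply: rt_step. Qed.

Lemma step_input q g a s p g' s' t :
  step (q, g, a :: s) ((p, g', s') : config M) ->
  s' = s /\ step (q, g, a :: t) ((p, g', t) : config M).
Proof.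
move=> /stepP[g1 [A [b [s1 [p1 [w [-> [-> ->] dqA [-> -> ->]]]]]]]].
by split=> //; apply: Step.
Qed.

(** A step inspects only the first unread letter, so the moves made on [u] are the same whatever
    follows. Hence the quantification over [t]: the suffix can be exchanged later. *)
Lemma steps_split q g u v f :
  steps (q, g, u ++ v) (f, [::], [::]) ->
  exists q' g', (forall t, steps (q, g, u ++ t) (q', g', t)) /\
    steps (q', g', v) (f, [::], [::]).
Proof.
elim: u q g => [|a u IHu] q g /= run.
  by exists q, g; split=> // t; apply: rt_refl.
have [//|[[[p g1] s1] st rest]] := steps_first run.
have [s1E _] := step_input [::] st.
rewrite s1E in rest.
have [q' [g' [pre suf]]] := IHu _ _ rest.
exists q', g'; split=> // t; apply: steps_cons (pre t).
by case: (step_input (u ++ t) st).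
Qed.

Lemma steps_empty q s f :
  steps (q, [::], s) ((f, [::], [::]) : config M) -> s = [::].
Proof.
case/steps_first => [[]//|[c' /stepP[g' [A [a [s' [p [w []]]]]]]]].
by case: g'.
Qed.

(** The only letter pays for a single step, and that step removes only the top symbol; everything
    below it would survive. *)
Lemma steps_height1 q g a f :
  steps (q, g, [:: a]) ((f, [::], [::]) : config M) -> exists A, g = [:: A].
Proof.
case/steps_first => [//|[c' /stepP[g' [A [b [s' [p [w [-> [_ <-] _ ->]]]]]]]]].
case/steps_first => [[_]|[c'' /stepP[? [? [? [? [? [? [_ //]]]]]]]]].
by case: g' => // _; exists A.
Qed.

Lemma step_det (c d e : config M) : step c d -> step c e -> d = e.
Proof.
case: c => [[q g] s].
move=> /stepP[g1 [A1 [a1 [s1 [p1 [w1 [-> -> d1 ->]]]]]]].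
move=> /stepP[g2 [A2 [a2 [s2 [p2 [w2 [/rcons_inj[<- <-] [<- <-] d2 ->]]]]]]].
suff: (p1, w1) = (p2, w2) by case=> -> ->.
apply: contraTeq (rpda_delta_det q A1 a1) => neq; rewrite -ltnNge.
have sub : ([fset (p1, w1); (p2, w2)] `<=` rpda_delta q A1 a1)%fset.
  by rewrite fsubUset !fsub1set d1.
by have := fsubset_leq_card sub; rewrite cardfs2 neq.
Qed.

(** By determinism the two runs from [c] agree step by step, and [(f, [::], [::])] has no successor,
    so the accepting run cannot end before reaching [c']. *)
Lemma steps_factor (c c' : config M) f :
  steps c c' -> steps c (f, [::], [::]) -> steps c' (f, [::], [::]).
Proof.
move=> cc'; elim: (clos_rt_rt1n _ _ _ _ cc') => {c c' cc'} [//|c c1 c' st _ IH].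
case/steps_first => [def_c|[c2 st2 rest]].
  by move: st; rewrite def_c => /stepP[g [A [a [s [p [w [_ ]]]]]]].
by apply: IH; rewrite (step_det st st2).
Qed.

End Runs.

Definition bounded_run_language (N : nat) : language bool :=
  fun w => exists2 i, i < N & w = nseq i false ++ [:: true].

Lemma bounded_run_language_lower (N : nat) (M : rpda bool) :
  (forall w, bounded_run_language N w <-> accepted M w) ->
  N <= #|rpda_Q M| * #|rpda_Gamma M|.
Proof.
move=> LM; rewrite -card_prod -[X in X <= _]card_ord.
have reach (i : 'I_N) : exists c : rpda_Q M * rpda_Gamma M, forall t,
    steps (rpda_q0 M, rpda_init M, nseq i false ++ t) (c.1, [:: c.2], t).
  have [|f _ run] := (LM (nseq i false ++ [:: true])).1; first by exists i.
  have [q [g [pre /steps_height1[A def_g]]]] := steps_split run.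
  by exists (q, A) => t; rewrite /= -def_g.
have {reach} [c reach] := fin_all_exists reach.
suff sep (i j : 'I_N) : i < j -> c i <> c j.
  apply: (@leq_card _ _ c) => i j eq_c; apply/val_inj.
  by case: (ltngtP i j) => // /sep; rewrite eq_c.
move=> lt_ij eq_c.
(* [t] completes [i] letters [false] to the longest word of the language; after [j > i] of them it
   gives a word that is too long. *)
pose t := nseq (N.-1 - i) false ++ [:: true].
have [|f acc_f run_i] := (LM (nseq i false ++ t)).1.
  have le_iN : i <= N.-1 by have := ltn_ord i; lia.
  by exists N.-1; [have := ltn_ord i; lia | rewrite catA -nseqD subnKC].
have run_j := steps_factor (reach i t) run_i.
rewrite eq_c in run_j.
have [|k lt_kN def_k] := (LM (nseq j false ++ t)).2.
  by exists f => //; apply: rt_trans (reach j t) run_j.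
have := congr1 size def_k; rewrite !size_cat !size_nseq /=.
by move=> eq_size; have := ltn_ord j; lia.
Qed.

Section Witness.

Variables m n : nat.

(** The successors make both types inhabited, so that [ord0] can serve as a default. The number of
    states is [m.+1], not [m]. *)
Let Q : finType := 'I_m.+1.
Let Gamma : finType := 'I_n.+1.

Let N := (m.+1 * n.+1)%N.

Definition pair_of_rank (i : nat) : Q * Gamma :=
  nth (ord0, ord0) (enum {: Q * Gamma}) i.

Definition rank_of_pair (c : Q * Gamma) : nat :=
  index c (enum {: Q * Gamma}).

Lemma size_enum_pairs : size (enum {: Q * Gamma}) = N.
Proof. by rewrite -cardE card_prod !card_ord. Qed.

Lemma pair_of_rankK i : i < N -> rank_of_pair (pair_of_rank i) = i.
Proof.
by move=> ltiN; rewrite /rank_of_pair index_uniq ?enum_uniq ?size_enum_pairs.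
Qed.

(** The pushdown keeps height one until [true] empties it, so state and symbol together form one
    counter. The empty set at rank [N.-1] blocks the [N]-th [false]. *)
Definition counter_delta (q : Q) (A : Gamma) (a : bool) :
    {fset Q * seq Gamma} :=
  let i := (rank_of_pair (q, A)).+1 in
  if a then [fset (q, [::])]%fset
  else if i < N then
    [fset ((pair_of_rank i).1, [:: (pair_of_rank i).2])]%fset
  else fset0.

Lemma counter_delta_det q A a : #|` counter_delta q A a| <= 1.
Proof.
by rewrite /counter_delta; do 2?case: ifP => _; rewrite ?cardfs1 ?cardfs0.
Qed.

Lemma card_bool_gt0 : 0 < #|{: bool}|.
Proof. by rewrite card_bool. Qed.

Lemma counter_init_wf :
  if #|Q| == 1 then 0 < size [:: (pair_of_rank 0).2]
  else size [:: (pair_of_rank 0).2] == 1.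
Proof. by case: ifP. Qed.

(** Every state accepts, because [true] may arrive at any rank and leaves the state as it is. *)
Definition counter_rpda : rpda bool :=
  @Rpda _ Q Gamma counter_delta (pair_of_rank 0).1 [:: (pair_of_rank 0).2] setT
    card_bool_gt0 counter_delta_det counter_init_wf.

(** The start rank [i] is arbitrary for the sake of the induction: reading [false] trades one unit
    of [k] for one of [i]. *)
Lemma counter_rpda_run i k : i + k < N ->
  exists f, @steps _ counter_rpda
    ((pair_of_rank i).1, [:: (pair_of_rank i).2], nseq k false ++ [:: true])
    (f, [::], [::]).
Proof.
elim: k i => [|k IHk] i ltN.
  exists (pair_of_rank i).1; apply: rt_step.
  apply: (@Step _ counter_rpda _ [::] _ _ _ _ [::]).
  by rewrite /= /counter_delta inE.
have [|f run] := IHk i.+1; first by rewrite addSnnS.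
exists f; apply: steps_cons run.
apply: (@Step _ counter_rpda _ [::] _ _ _ _ [:: (pair_of_rank i.+1).2]).
rewrite /= /counter_delta -surjective_pairing pair_of_rankK; last by lia.
by rewrite ifT ?inE //; lia.
Qed.

Lemma counter_rpda_run_inv i w f : i < N ->
  @steps _ counter_rpda ((pair_of_rank i).1, [:: (pair_of_rank i).2], w)
    (f, [::], [::]) ->
  exists2 k, i + k < N & w = nseq k false ++ [:: true].
Proof.
elim: w i => [|a w IHw] i ltiN.
  by case/steps_first => [//|[c /stepP[? [? [? [? [? [? [_ //]]]]]]]]].
case/steps_first => [//|[c /stepP[g [A [b [s [p [u [def_g [<- <-] + ->]]]]]]]]].
case: g def_g => [[<-]|? [] //].
rewrite /= /counter_delta -surjective_pairing pair_of_rankK //.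
(* Reading [true] empties the pushdown, after which no letter can be read; reading [false] leads to
   rank [i.+1], where the induction hypothesis applies. *)
case: a => [|]; first rewrite inE => /eqP[-> ->].
  by move/steps_empty => ->; exists 0; rewrite ?addn0.
case: ifP => // ltSiN; rewrite inE => /eqP[-> ->] /(IHw _ ltSiN)[k ltkN ->].
by exists k.+1; rewrite // -addSnnS.
Qed.

Lemma counter_rpda_language w :
  bounded_run_language N w <-> accepted counter_rpda w.
Proof.
split=> [[k ltkN ->]|[f _ run]].
  have [//|f run] := @counter_rpda_run 0 k; exists f => //.
  by rewrite /accepting /= inE orbT.
by have [//|k ltkN ->] := counter_rpda_run_inv _ run; exists k.
Qed.

End Witness.

Theorem theorem4 (m n : nat) (hm : 1 <= m) (hn : 1 <= n) :
  proper_subfamily (RPDA m n) (RPDA m n.+1) /\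
  exists (Sigma : finType) (L : language Sigma),
    [/\ #|Sigma| = 2, RPDA m n.+1 Sigma L & ~ RPDA m n Sigma L].
Proof.
have mem : RPDA m n.+1 bool (bounded_run_language (m * n.+1)).
  case: m hm => // m' _; exists (counter_rpda m' n).
  by split; rewrite ?card_ord //; apply: counter_rpda_language.
have not_mem : ~ RPDA m n bool (bounded_run_language (m * n.+1)).
  case=> M [cardQ cardG /bounded_run_language_lower]; rewrite cardQ leq_pmul2l //.
  by move=> /leq_trans/(_ cardG); rewrite ltnn.
split; last by exists bool, (bounded_run_language (m * n.+1)); rewrite card_bool.
split=> [Sigma L [M [cardQ cardG LM]]|sub]; last exact/not_mem/sub.
by exists M; split=> //; apply: leqW.
Qed.
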